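(* Let $q=p^{r}$ where $p$ is an odd prime and $r$ is a positive integer. If $\rho(q+1)=1/2$, then the cyclotomic polynomial $\Phi_{2p}$ divides the descent set polynomial $Q_{q+1}(t)$. Furthermore, if in addition $q\equiv 3 \bmod 4$, then $\Phi_{2p}$ is a double factor of $Q_{q+1}(t)$, that is, $\Phi_{2p}^2$ divides $Q_{q+1}(t)$.
   Context: For a permutation $\pi$ in the symmetric group $\mathfrak{S}_n$, its descent set is $\mathrm{Des}(\pi)=\{i\in[n-1] : \pi_i>\pi_{i+1}\}$, where $[n-1]=\{1,\dots,n-1\}$. For $S\subseteq[n-1]$ let $\beta_n(S)=|\{\pi\in\mathfrak{S}_n : \mathrm{Des}(\pi)=S\}|$. The $n$th descent set polynomial is $Q_n(t)=\sum_{S\subseteq[n-1]}t^{\beta_n(S)}$. The proportion of odd descent set statistics is $\rho(n)=|\{S\subseteq[n-1] : \beta_n(S)\equiv 1 \bmod 2\}|/2^{n-1}$. $\Phi_m(t)$ denotes the $m$th cyclotomic polynomial; divisibility is in $\mathbb{Q}[t]$. *)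

(* Defs.v *)
From mathcomp Require Import all_boot all_order all_fingroup all_algebra all_field.

Set Implicit Arguments.
Unset Strict Implicit.
Unset Printing Implicit Defensive.

Import GRing.Theory Num.Theory.
Local Open Scope ring_scope.

(* Everything is 0-indexed: {1, ..., n} is 'I_n and the set [n-1] of possible
   descents is 'I_n.-1, where i : 'I_n.-1 stands for the 1-based position i+1,
   which compares the entries of s at the 0-based indices i and i+1. *)

Lemma succ_pos_subproof n (i : 'I_n.-1) : (i.+1 < n)%N.
Proof. by rewrite -ltn_predRL. Qed.

Definition pos n (i : 'I_n.-1) : 'I_n := widen_ord (leq_pred n) i.

Definition succ_pos n (i : 'I_n.-1) : 'I_n := Ordinal (succ_pos_subproof i).

Definition Des n (s : 'S_n) : {set 'I_n.-1} :=
  [set i : 'I_n.-1 | (s (succ_pos i) < s (pos i))%N].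

Definition beta n (S : {set 'I_n.-1}) : nat := #|[set s : 'S_n | Des s == S]|.

Definition descent_poly n : {poly rat} :=
  \sum_(S : {set 'I_n.-1}) 'X^(beta S).

Definition rho n : rat :=
  #|[set S : {set 'I_n.-1} | odd (beta S)]|%:R / 2 ^+ n.-1.

Definition Phi_rat m : {poly rat} := map_poly intr 'Phi_m.

(* Main.v *)
Require Import Defs.
From mathcomp Require Import all_boot all_order all_fingroup all_algebra all_field.
From mathcomp Require Import zify.

Import GRing.Theory Num.Theory.
Local Open Scope ring_scope.

Set Implicit Arguments.
Unset Strict Implicit.
Unset Printing Implicit Defensive.

(* Let n = q + 1, let z be a primitive 2p-th root of unity and w = - z, a p-th
   root of unity, so that z ^ beta S = (-1) ^ beta S * w ^ beta S.  Let S + i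
   be S with the membership of i toggled.  The number beta S + beta (S + i)
   counts the permutations whose descent set agrees with S off i, so it is a
   multiple of the binomial coefficient 'C(n, i) (positions 1-based).  Hence
   (-1) ^ beta S is unchanged by toggling an odd position, or, when 4 divides
   n, a position not divisible by 4, while w ^ beta S is inverted by toggling
   a position other than 1 and q.  Both are invariant under complement.

   In Fourier expansion over the cube of sets S, this leaves for w ^ beta only
   the characters indexed by the empty set, {1, q}, and the complements of {1}
   and of {q}; for (-1) ^ beta only even-size sets of even positions (resp.
   of positions divisible by 4), and not the empty set because rho n = 1/2.
   The two supports are disjoint, so the sum of z ^ beta S vanishes by Parseval.

   For the derivative, the sum of beta S * z ^ beta S is a sum over all
   permutations s of products of two characters evaluated at Des s.  Each such
   product is a character indexed by a set having a maximal run of consecutive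
   positions of odd length; reversing the corresponding block of entries of s
   negates the character, so every sum vanishes. *)

(** * Fourier analysis on the cube of subsets *)

Section Characters.

Variables (I : finType) (R : numFieldType).
Implicit Types (A B K S T : {set I}) (f g : {set I} -> R).

Definition symd A B := [set i | (i \in A) (+) (i \in B)].

Lemma in_symd A B i : (i \in symd A B) = (i \in A) (+) (i \in B).
Proof. by rewrite inE. Qed.

Lemma symdC A B : symd A B = symd B A.
Proof. by apply/setP=> i; rewrite !in_symd addbC. Qed.

Lemma symdA A B S : symd A (symd B S) = symd (symd A B) S.
Proof. by apply/setP=> i; rewrite !in_symd addbA. Qed.

Lemma symdK T : involutive (symd^~ T).
Proof. by move=> A; apply/setP=> i; rewrite !in_symd addbK. Qed.

Lemma symdT A : symd A setT = ~: A.
Proof. by apply/setP=> i; rewrite !inE addbT. Qed.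

(** The Walsh character, -1 to the size of [K :&: S], kept as a product so that identities are
    checked factor by factor. *)
Definition chi K S : R := \prod_i (-1) ^+ ((i \in K) && (i \in S)).

Lemma chiC K S : chi K S = chi S K.
Proof. by apply: eq_bigr => i _; rewrite andbC. Qed.

Lemma chi_symdr K S T : chi K (symd S T) = chi K S * chi K T.
Proof.
rewrite /chi -big_split /=; apply: eq_bigr => i _.
by rewrite in_symd andb_addr signr_addb.
Qed.

Lemma chi_symdl K L S : chi (symd K L) S = chi K S * chi L S.
Proof. by rewrite !(chiC _ S) chi_symdr. Qed.

Lemma chi0 S : chi set0 S = 1.
Proof. by rewrite /chi big1 // => i _; rewrite inE. Qed.

Lemma chi1 K i : chi K [set i] = (-1) ^+ (i \in K).
Proof.
rewrite /chi (bigD1 i) //= inE eqxx andbT big1 ?mulr1 // => j /negbTE nij.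
by rewrite inE nij andbF.
Qed.

Lemma chiT K : chi K setT = (-1) ^+ #|K|.
Proof.
rewrite /chi -sum1_card -prodrXr [RHS]big_mkcond /=; apply: eq_bigr => i _.
by rewrite inE andbT; case: (i \in K).
Qed.

Lemma eq_opp0 (x : R) : x = - x -> x = 0.
Proof. by move=> E; apply/eqP; rewrite -eqNr -E. Qed.

Lemma sum_chi S : \sum_K chi K S = if S == set0 then 2 ^+ #|I| else 0.
Proof.
have [->|/set0Pn[i iS]] := eqVneq.
  under eq_bigr do rewrite chiC chi0.
  have card_sets : #|{: {set I}}| = (2 ^ #|I|)%N.
    by rewrite -[in RHS]cardsT -card_powerset powersetT cardsT.
  by rewrite sumr_const card_sets natrX.
apply: eq_opp0; rewrite {1}(reindex_inj (inv_inj (symdK [set i]))) /= -sumrN.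
apply: eq_bigr => K _.
by rewrite chi_symdl [X in _ * X]chiC chi1 iS mulrN1.
Qed.

Definition fourier f K : R := \sum_S f S * chi K S.

(** Translating the summation variable by [T] turns the coefficient into its negative. *)
Lemma fourier_eq0 f K T :
  (forall S, f (symd S T) = f S) -> chi K T = -1 -> fourier f K = 0.
Proof.
move=> fT KT; apply: eq_opp0.
rewrite /fourier {1}(reindex_inj (inv_inj (symdK T))) /= -sumrN.
by apply: eq_bigr => S _; rewrite fT chi_symdr KT !mulrN1 mulrN.
Qed.

Lemma fourier_inversion f S :
  2 ^+ #|I| * f S = \sum_K fourier f K * chi K S.
Proof.
under eq_bigr do rewrite mulr_suml.
rewrite exchange_big /= (bigD1 S) //= [X in _ + X]big1 ?addr0 => [|T nTS].
  under eq_bigr => K _ do rewrite -mulrA -chi_symdr.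
  have -> : symd S S = set0 by apply/setP=> i; rewrite !inE addbb.
  by rewrite -mulr_sumr sum_chi eqxx mulrC.
under eq_bigr => K _ do rewrite -mulrA -chi_symdr.
rewrite -mulr_sumr sum_chi ifN ?mulr0 //; apply: contraNneq nTS => E.
by rewrite -(symdK S T) E; apply/eqP/setP=> i; rewrite !inE.
Qed.

(** Parseval: expand [f] by inversion, then exchange the sums. *)
Lemma sum_fourier f g :
  2 ^+ #|I| * \sum_S f S * g S = \sum_K fourier f K * fourier g K.
Proof.
rewrite mulr_sumr.
under eq_bigr => S _ do rewrite mulrA fourier_inversion mulr_suml.
rewrite exchange_big; apply: eq_bigr => K _ /=.
by rewrite mulr_sumr; apply: eq_bigr => S _; rewrite -mulrA (mulrC (chi _ _)).
Qed.

End Characters.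

(** * Descent sets under reversals *)

Section Descents.

Variable n : nat.
Implicit Types (s : 'S_n) (S M : {set 'I_n.-1}) (i : 'I_n.-1).

Lemma in_Des s i : (i \in Des s) = (s (succ_pos i) < s (pos i))%N.
Proof. by rewrite inE. Qed.

(** The left factor of a product acts first, so the values are reversed and every comparison
    flips. *)
Lemma Des_mul_rev s : Des (s * perm rev_ord_inj) = ~: Des s.
Proof.
apply/setP=> i; rewrite in_setC !in_Des !permM !permE /=.
have := @perm_inj _ s (pos i) (succ_pos i).
have : pos i <> succ_pos i by move/(congr1 val) => /=; lia.
move=> ne /(_ _) inj.
have : s (pos i) <> s (succ_pos i) :> nat by move=> E; apply: ne; apply: inj; apply: val_inj.
have := ltn_ord (s (pos i)); have := ltn_ord (s (succ_pos i)).
lia.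
Qed.

Lemma beta_setC S : beta (~: S) = beta S.
Proof.
rewrite /beta -[RHS](card_imset _ (mulIg (perm (@rev_ord_inj n)))).
apply: eq_card => s; rewrite !inE; apply/eqP/imsetP => [E | [t]].
  exists (s * (perm rev_ord_inj)^-1)%g; rewrite ?mulgKV // inE.
  by rewrite -[Des _]setCK -Des_mul_rev mulgKV E setCK.
by rewrite inE => /eqP <- ->; rewrite Des_mul_rev.
Qed.

Section Block.

Variables a b : nat.
Hypotheses (le_bn : (b < n)%N).

Definition rev_block_nat x := if (a <= x <= b)%N then (a + b - x)%N else x.

Lemma rev_block_subproof (x : 'I_n) : (rev_block_nat x < n)%N.
Proof. rewrite /rev_block_nat; have := ltn_ord x; case: ifP; lia. Qed.

Definition rev_block_ord x := Ordinal (rev_block_subproof x).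

Lemma rev_block_ord_inj : injective rev_block_ord.
Proof.
apply: (can_inj (g := rev_block_ord)) => x; apply: val_inj => /=.
by rewrite /rev_block_nat; case: ifP; case: ifP; lia.
Qed.

Definition rev_block : 'S_n := perm rev_block_ord_inj.

Lemma rev_descent_subproof i :
  ((if (a <= i < b)%N then a + b - i.+1 else i) < n.-1)%N.
Proof. by have := ltn_ord i; case: ifP; lia. Qed.

Definition rev_descent i := Ordinal (rev_descent_subproof i).

Lemma rev_descentK : involutive rev_descent.
Proof.
by move=> i; apply: val_inj => /=; case: (boolP (a <= i < b)%N); case: ifP; lia.
Qed.

(** Here positions are reversed: comparisons inside the block are mirrored and flipped, those
    outside stay. The two excluded positions straddle an end of the block. *)
Lemma in_Des_rev_block s i : i.+1 != a -> i != b :> nat ->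
  (i \in Des (rev_block * s)) = (rev_descent i \in Des s) (+) (a <= i < b)%N.
Proof.
move=> ia ib; rewrite !in_Des !permM !permE.
case: (boolP (a <= i < b)%N) => iab; last first.
  rewrite addbF; congr (s _ < s _)%N; apply: val_inj => /=;
  by rewrite /rev_block_nat (negbTE iab); case: ifP; lia.
have -> : rev_block_ord (succ_pos i) = pos (rev_descent i).
  by apply: val_inj; rewrite /= /rev_block_nat iab; case: ifP; lia.
have -> : rev_block_ord (pos i) = succ_pos (rev_descent i).
  by apply: val_inj; rewrite /= /rev_block_nat iab; case: ifP; lia.
set j := rev_descent i.
have : s (pos j) <> s (succ_pos j) :> nat.
  by move=> E; have /(congr1 val)/= := perm_inj (val_inj E); lia.
by lia.
Qed.

(** The interval [a, b) is a run of [M] with neither neighbour in [M]. Reversing the block permutes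
    the factors of the character and flips those of the run, which are odd in number. *)
Lemma sum_chi_Des_eq0 (R : numFieldType) M : odd (b - a) ->
    (forall i, i \in M -> i.+1 != a /\ i != b :> nat) ->
    (forall i, (a <= i < b)%N -> i \in M) ->
  \sum_s chi R M (Des s) = 0.
Proof.
move=> odd_ba bdM runM; apply: eq_opp0.
rewrite {1}(reindex_inj (mulgI rev_block)) /= -sumrN; apply: eq_bigr => s _.
have inM i : (rev_descent i \in M) = (i \in M).
  case: (boolP (a <= i < b)%N) => iab; last first.
    by congr (_ \in M); apply: val_inj; rewrite /= (negbTE iab).
  by rewrite !runM //= iab; lia.
rewrite /chi.
have -> : \prod_i (-1) ^+ ((i \in M) && (i \in Des (rev_block * s))) =
    \prod_i ((-1) ^+ ((rev_descent i \in M) && (rev_descent i \in Des s)) *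
             (-1) ^+ (a <= i < b)%N) :> R.
  apply: eq_bigr => i _; rewrite inM; case: (boolP (i \in M)) => iM /=.
    have [ia ib] := bdM i iM.
    by rewrite in_Des_rev_block // signr_addb.
  by case: (boolP (a <= i < b)%N) => [/runM|]; rewrite ?(negbTE iM) ?mulr1.
rewrite big_split /= [in RHS](reindex_inj (inv_inj rev_descentK)) /= [X in _ * X]prodrXr.
suff -> : (\sum_(i < n.-1) (a <= i < b) = b - a)%N.
  by rewrite -signr_odd odd_ba mulrN1.
rewrite -(big_mkord predT (fun j => nat_of_bool (a <= j < b)%N)) /=.
rewrite -big_mkcond /= -big_filter sum1_size.
have -> : [seq j <- index_iota 0 n.-1 | (a <= j < b)%N] = index_iota a b.
  apply: (irr_sorted_eq ltn_trans ltnn).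
  - exact: (sorted_filter ltn_trans _ (iota_ltn_sorted _ _)).
  - exact: iota_ltn_sorted.
  by move=> j; rewrite mem_filter !mem_index_iota; lia.
by rewrite size_iota.
Qed.

End Block.

End Descents.

(** * Toggling one position: divisibility by binomial coefficients *)

Section Toggle.

Variable n : nat.
Implicit Types (s : 'S_n) (A : {set 'I_n}) (S : {set 'I_n.-1}) (i : 'I_n.-1).

(** The witness sends [x] to its rank, the number of points with smaller [kappa]. *)
Lemma exists_relabel (kappa : 'I_n -> nat) : injective kappa ->
  exists sigma : 'S_n, forall x y, (sigma x < sigma y)%N = (kappa x < kappa y)%N.
Proof.
move=> inj_k; pose L x := [set y : 'I_n | (kappa y < kappa x)%N].
have ltL x y : (kappa x < kappa y)%N -> (#|L x| < #|L y|)%N.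
  move=> xy; apply: proper_card; apply/properP; split.
    by apply/subsetP=> z; rewrite !inE => /ltn_trans; apply.
  by exists x; rewrite !inE ?ltnn.
have lt_Ln x : (#|L x| < n)%N.
  rewrite -[X in (_ < X)%N]card_ord -cardsT; apply: proper_card.
  by apply/properP; split; [apply: subsetT | exists x; rewrite ?inE ?ltnn].
pose f x := Ordinal (lt_Ln x).
have ltf x y : (f x < f y)%N = (kappa x < kappa y)%N.
  apply/idP/idP => /= [|/ltL //]; case: (ltngtP (kappa x) (kappa y)) => //.
    by move/ltL/ltnW; rewrite leqNgt => /negbTE->.
  by move/inj_k->; rewrite ltnn.
have inj_f : injective f.
  move=> x y E; apply: inj_k; have := ltf x y; have := ltf y x.
  by rewrite E ltnn; lia.
by exists (perm inj_f) => x y; rewrite !permE.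
Qed.

Definition prefix_pos m := [set x : 'I_n | (x < m)%N].

Lemma card_prefix_pos m : (m <= n)%N -> #|prefix_pos m| = m.
Proof.
move=> le_mn; rewrite -[RHS]card_ord -cardsT.
have inj_w : injective (widen_ord le_mn) by move=> x y [/val_inj].
rewrite -(card_imset _ inj_w).
apply: eq_card => x; rewrite inE; apply/idP/imsetP => [xm | [y _ ->]].
  by exists (Ordinal xm) => //; apply: val_inj.
by rewrite /= ltn_ord.
Qed.

Lemma exists_collect A : exists sigma : 'S_n,
  sigma @: A = prefix_pos #|A| /\
  forall x y, (x \in A) = (y \in A) -> (sigma x < sigma y)%N = (x < y)%N.
Proof.
(* Adding [n] pushes the points outside [A] beyond those of [A] and keeps the order on each side. *)
pose kappa (x : 'I_n) := (x + n * (x \notin A))%N.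
have ltk (x y : 'I_n) : (kappa x < kappa y)%N =
    if (x \in A) == (y \in A) then (x < y)%N else x \in A.
  have := ltn_ord x; have := ltn_ord y; rewrite /kappa.
  by case: (x \in A); case: (y \in A) => /=; lia.
have inj_k : injective kappa.
  move=> x y E; apply: val_inj; have := ltk x y; have := ltk y x.
  by rewrite E ltnn; case: (x \in A); case: (y \in A) => //=; lia.
have [sigma sigmaE] := exists_relabel inj_k; exists sigma; split; last first.
  by move=> x y xy; rewrite sigmaE ltk xy eqxx.
apply/eqP; rewrite eqEcard; apply/andP; split; last first.
  by rewrite (card_imset _ perm_inj) card_prefix_pos // -[X in (_ <= X)%N]card_ord max_card.
apply/subsetP=> _ /imsetP[x xA ->]; rewrite inE.
(* All values below [sigma x] come from [A], as does [sigma x] itself; counting them gives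
   [sigma x < #|A|]. *)
have le_xn : (sigma x <= n)%N := ltnW (ltn_ord _).
rewrite -[X in (X < _)%N](card_prefix_pos le_xn) -(card_imset A (@perm_inj _ sigma)).
apply: proper_card; apply/properP; split; last first.
  by exists (sigma x); [apply: imset_f | rewrite inE ltnn].
apply/subsetP=> z; rewrite inE -(permKV sigma z) sigmaE ltk => zx.
by apply: imset_f; move: zx; rewrite xA; case: (_ \in A).
Qed.

(* All the fibres of the set of values of the first i.+1 entries have the same
   size, because relabelling increasingly on that set and on its complement
   keeps every descent other than i. *)
Lemma dvdn_beta_toggle S i :
  ('C(n, i.+1) %| beta S + beta (symd S [set i]))%N.
Proof.
have le_in : (i.+1 <= n)%N by have := ltn_ord i; lia.
pose X := [set s : 'S_n | Des s :\ i == S :\ i].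
pose first s := s @: prefix_pos i.+1.
have -> : (beta S + beta (symd S [set i]) = #|X|)%N.
  rewrite /beta -cardsUI [X in (_ + X)%N]eq_card0 ?addn0 => [|s]; last first.
    rewrite !inE; apply/negP => /andP[/eqP -> /eqP/setP/(_ i)].
    by rewrite in_symd inE eqxx addbT; case: (i \in S).
  apply: eq_card => s; rewrite !inE; apply/orP/eqP => [[/eqP-> //|/eqP->]|E].
    by apply/setP=> j; rewrite !inE; case: (j == i); rewrite ?addbF.
  have [ei|nei] := eqVneq (i \in Des s) (i \in S); [left|right];
    apply/eqP/setP=> j; move/setP/(_ j): E; rewrite ?in_symd !in_setD1 ?in_set1;
    have [->|nj] //= := eqVneq j i; rewrite ?addbF //.
  by move: nei; case: (i \in Des s); case: (i \in S).
have fiberE A : #|A| = i.+1 ->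
    #|[set s in X | first s == A]| = #|[set s in X | first s == prefix_pos i.+1]|.
  move=> cA; have [sigma [sA sigma_lt]] := exists_collect A.
  rewrite -[RHS](card_preimset _ (mulIg sigma)); apply: eq_card => s.
  have fE : first (s * sigma)%g = sigma @: first s.
    by rewrite /first -imset_comp; apply: eq_imset => x; rewrite permM.
  rewrite [in LHS]inE [in RHS]inE [in RHS]inE fE -cA -sA.
  rewrite (inj_eq (imset_inj perm_inj)); have [fs|] := eqVneq; rewrite ?andbF //.
  rewrite !andbT !inE; congr (_ == _); apply/setP=> j; rewrite !in_setD1.
  (* For [j != i] the two compared positions lie on the same side of the cut, so their values are
     both in [A] or both outside it. *)
  have [//|nj] /= := eqVneq j i; rewrite !in_Des !permM; symmetry; apply: sigma_lt.
  rewrite -fs /first !(mem_imset _ _ perm_inj) !inE /=.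
  have : j != i :> nat by [].
  by lia.
rewrite -sum1_card (partition_big first (fun A => #|A| == i.+1)) /= => [|s _]; last first.
  by rewrite (card_imset _ perm_inj) card_prefix_pos.
under eq_bigr => A /eqP cA.
  rewrite (eq_bigl [in [set s in X | first s == A]]) ?sum1_card ?fiberE //.
    over.
  by move=> s; rewrite !inE.
rewrite sum_nat_const -cardsE card_draws card_ord.
exact: dvdn_mulr.
Qed.

End Toggle.

(** For m > 0, m C(n, m) = n C(n-1, m-1): if [p] did not divide C(n, m), then [p ^ k] would divide
    [m]. *)
Lemma dvdn_bin p k n m : prime p -> (p ^ k %| n)%N -> ~~ (p ^ k %| m)%N ->
  (p %| 'C(n, m))%N.
Proof.
move=> p_pr pn; case: m => [|m]; first by rewrite dvdn0.
apply: contraR => npC; rewrite -(@Gauss_dvdl _ _ 'C(n, m.+1)).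
  by rewrite -mul_bin_diag dvdn_mulr.
by rewrite coprime_sym coprimeXr // coprime_sym prime_coprime.
Qed.

(** * Divisibility by a cyclotomic polynomial and by its square *)

Section CyclotomicFactors.

Variables (m : nat) (z : algC).
Hypothesis prim_z : m.-primitive_root z.
Implicit Type P : {poly rat}.

(** The cyclotomic polynomial is the minimal polynomial of [z] over the rationals. *)
Lemma dvdp_Phi_rat P : (Phi_rat m %| P) = root (map_poly ratr P) z.
Proof.
have [f [Df _] ->] := minCpolyP z; congr (_ %| _).
apply: (map_poly_inj (ratr : {rmorphism rat -> algC})) => /=.
rewrite -Df (minCpoly_cyclotomic prim_z) -(Cintr_Cyclotomic prim_z).
rewrite /Phi_rat -map_poly_comp /=.
by apply: eq_map_poly => x /=; rewrite ratr_int.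
Qed.

(** Write P = G F with F cyclotomic. Then F divides G F' but, by degree, not F', so G vanishes at
    [z]. *)
Lemma dvdp_sqr_Phi_rat P :
  root (map_poly ratr P) z -> root (map_poly ratr P^`()) z ->
  Phi_rat m ^+ 2 %| P.
Proof.
rewrite -!dvdp_Phi_rat; set F := Phi_rat m => /dvdpP[G ->].
have monF : F \is monic by rewrite monic_map ?Cyclotomic_monic.
have sF : (1 < size F)%N.
  have : root (map_poly ratr F) z by rewrite -dvdp_Phi_rat.
  by move/root_size_gt1; rewrite size_map_poly; apply; rewrite map_poly_eq0 monic_neq0.
have F'0 : F^`() != 0.
  apply/eqP => /polyP/(_ (size F).-2); rewrite coef_deriv coef0 => /eqP.
  have -> : (size F).-2.+1 = (size F).-1 by lia.
  by rewrite -lead_coefE (monicP monF) pnatr_eq0; lia.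
have ndvd : ~~ (F %| F^`()).
  by apply: contraTN (lt_size_deriv (monic_neq0 monF)) => /(dvdp_leq F'0); rewrite -leqNgt.
rewrite derivM (dvdp_addr _ (dvdp_mull _ (dvdpp _))) expr2 dvdp_mul2r ?monic_neq0 //.
by move: ndvd; rewrite !dvdp_Phi_rat rmorphM rootM => /negbTE->; rewrite orbF.
Qed.

End CyclotomicFactors.

Lemma consecutive_elements m (L : {set 'I_m}) : (1 < #|L|)%N ->
  exists k k', [/\ k \in L, k' \in L, (k < k')%N
                 & forall j : 'I_m, (k < j < k')%N -> j \notin L].
Proof.
move=> L2; have [x xL] : exists x, x \in L by apply/card_gt0P; lia.
case: (@arg_minnP _ x (fun i => i \in L) val xL) => k kL kmin.
have [y yL] : exists y, y \in L :\ k.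
  by apply/card_gt0P; move: L2; rewrite (cardsD1 k) kL.
case: (@arg_minnP _ y (fun i => i \in L :\ k) val yL) => k' /=.
rewrite in_setD1 => /andP[nk k'L] k'min; exists k, k'; split=> // [|j kj].
  by have /= := kmin _ k'L; have : k' != k :> nat by []; lia.
apply/negP => jL; have /= := k'min j; rewrite in_setD1 jL andbT.
have jk : j != k by apply: contraTneq kj => ->; rewrite ltnn.
by move=> /(_ jk); lia.
Qed.

(** * Symmetries of the descent statistics and their Fourier coefficients *)

Section DescentStatistics.

Variables (n : nat) (R : numFieldType).
Implicit Types (S K : {set 'I_n.-1}) (i : 'I_n.-1).

Lemma sum_beta (f : {set 'I_n.-1} -> R) :
  \sum_S f S * (beta S)%:R = \sum_(s : 'S_n) f (Des s).
Proof.
rewrite [RHS](partition_big (@Des n) xpredT) //=; apply: eq_bigr => S _.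
rewrite (eq_bigr (fun=> f S)) => [|s /eqP-> //].
by rewrite sumr_const mulr_natr; congr (_ *+ _); apply: eq_card => s; rewrite inE.
Qed.

(** Complementing [S] preserves [beta S] but negates the character of a set of odd size. *)
Lemma fourier_beta_odd (f : nat -> R) K : odd #|K| ->
  fourier (fun S => f (beta S)) K = 0.
Proof.
move=> oK; apply: (@fourier_eq0 _ _ _ _ setT) => [S|].
  by rewrite symdT beta_setC.
by rewrite chiT -signr_odd oK.
Qed.

Definition sgn_beta S : R := (-1) ^+ beta S.

(** The binomial dividing the sum of the two statistics is even, so they have equal parity; [i.+1]
    is the 1-based position. *)
Lemma sgn_beta_toggle k S i : (2 ^ k %| n)%N -> ~~ (2 ^ k %| i.+1)%N ->
  sgn_beta (symd S [set i]) = sgn_beta S.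
Proof.
move=> kn ki; have := dvdn_trans (dvdn_bin (isT : prime 2) kn ki) (dvdn_beta_toggle S i).
rewrite /sgn_beta dvdn2 oddD -(signr_odd _ (beta S)) -(signr_odd _ (beta (symd _ _))).
by case: (odd _); case: (odd _).
Qed.

Lemma fourier_sgn_beta_eq0 k K i : (2 ^ k %| n)%N -> ~~ (2 ^ k %| i.+1)%N ->
  i \in K -> fourier sgn_beta K = 0.
Proof.
move=> kn ki iK; apply: (@fourier_eq0 _ _ _ _ [set i]) => [S|].
  exact: sgn_beta_toggle kn ki.
by rewrite chi1 iK.
Qed.

End DescentStatistics.

(** * Vanishing sums for n = q + 1 *)

Section PrimePower.

Variables (p r q : nat) (w : algC).
Hypotheses (p_prime : prime p) (q_def : q = (p ^ r)%N).
Hypotheses (q_odd : odd q) (q_gt2 : (2 < q)%N).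
Hypothesis rho_half : rho q.+1 = 1 / 2.
Hypothesis wp1 : w ^+ p = 1.

Local Notation sgn := (@sgn_beta q.+1 algC).

Definition pow_beta (S : {set 'I_q.+1.-1}) : algC := w ^+ beta S.

Lemma first_pos_subproof : (0 < q.+1.-1)%N. Proof. by rewrite /=; lia. Qed.
Lemma last_pos_subproof : (q.-1 < q.+1.-1)%N. Proof. by rewrite /=; lia. Qed.
Definition first_pos : 'I_q.+1.-1 := Ordinal first_pos_subproof.
Definition last_pos : 'I_q.+1.-1 := Ordinal last_pos_subproof.

Definition inner (i : 'I_q.+1.-1) := (i != first_pos) && (i != last_pos).

Lemma innerE i : inner i = (0 < i < q.-1)%N.
Proof.
rewrite /inner -!val_eqE /=; have := ltn_ord i; rewrite /=; lia.
Qed.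

(** This is what [rho_half] provides: odd and even statistics are equally many, so the coefficient
    of [sgn] at the empty set is 0. *)
Lemma sum_sgn_beta : \sum_S sgn S = 0.
Proof.
pose O := [set S : {set 'I_q.+1.-1} | odd (beta S)].
have N : (#|O| * 2 = 2 ^ q)%N.
  apply/eqP; rewrite -(eqr_nat rat) natrM natrX; apply/eqP.
  move: rho_half; rewrite /rho -/O /=; set N := _%:R => E.
  have nz : 2 ^+ q != 0 :> rat by rewrite expf_neq0.
  by rewrite -[N](divfK nz) E div1r mulrAC mulVf ?mul1r.
have C : (#|O| + #|~: O| = 2 ^ q)%N.
  by rewrite cardsC -cardsT -powersetT card_powerset cardsT card_ord.
rewrite (bigID (mem O)) /= (eq_bigr (fun=> -1)) => [|S]; last first.
  by rewrite inE /sgn_beta -signr_odd => ->.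
rewrite [X in _ + X](eq_bigr (fun=> 1)) => [|S]; last first.
  by rewrite inE /sgn_beta -signr_odd => /negbTE->.
rewrite !sumr_const mulNrn addrC; apply/eqP; rewrite subr_eq0 eqr_nat.
have -> : #|[pred S | S \notin O]| = #|~: O| by apply: eq_card => S; rewrite !inE.
by rewrite -(eqn_add2l #|O|) C -N muln2 addnn.
Qed.

Lemma pow_beta_toggle S i : inner i ->
  pow_beta (symd S [set i]) * pow_beta S = 1.
Proof.
rewrite innerE => i_in.
have p_dvd : (p %| 'C(q.+1, i.+1))%N.
  have nq k : (0 < k < q)%N -> ~~ (q %| k)%N by move=> /andP[k0 kq]; rewrite gtnNdvd.
  (* Pascal's rule gives C(q, i+1) + C(q, i), both multiples of [p] since 0 < i and i + 1 < q. *)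
  by rewrite binS dvdn_add // (@dvdn_bin p r) -?q_def ?nq //; lia.
rewrite -exprD addnC.
have /dvdnP[k ->] := dvdn_trans p_dvd (dvdn_beta_toggle S i).
by rewrite mulnC exprM wp1 expr1n.
Qed.

Lemma pow_beta_toggle2 S i j : inner i -> inner j ->
  pow_beta (symd S (symd [set i] [set j])) = pow_beta S.
Proof.
move=> ini inj; rewrite symdA.
have := pow_beta_toggle (symd S [set i]) inj; rewrite -(pow_beta_toggle S ini).
rewrite mulrC; apply: mulfI; apply/eqP => E.
by have /eqP := pow_beta_toggle S ini; rewrite E mul0r eq_sym oner_eq0.
Qed.

(** Toggling two inner positions preserves [pow_beta], so [K] contains all or none of them. As
    [#|K|] is even and there are q - 2 inner positions, an odd number, the ends are constrained as
    stated. *)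
Lemma fourier_pow_beta_neq0 K : fourier pow_beta K != 0 ->
  (forall i, inner i -> i \notin K) /\ (first_pos \in K) = (last_pos \in K) \/
  (forall i, inner i -> i \in K) /\ (first_pos \in K) = (last_pos \notin K).
Proof.
move=> K0.
have evK : ~~ odd #|K|.
  by apply: contraNN K0 => oK; rewrite (@fourier_beta_odd _ _ (fun k => w ^+ k)).
have nfl : last_pos != first_pos by rewrite -val_eqE /=; lia.
pose K' := K :\ first_pos :\ last_pos.
have cK (A : {set 'I_q.+1.-1}) : #|A| =
    ((first_pos \in A) + (last_pos \in A) + #|A :\ first_pos :\ last_pos|)%N.
  by rewrite (cardsD1 first_pos) (cardsD1 last_pos (_ :\ _)) in_setD1 nfl addnA.
have inK' (A : {set 'I_q.+1.-1}) i :
    (i \in A :\ first_pos :\ last_pos) = inner i && (i \in A).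
  by rewrite !in_setD1 /inner; case: (i == first_pos); case: (i == last_pos).
have [/existsP[i /andP[ini iK]]|/existsPn none] :=
    boolP [exists i, inner i && (i \in K)]; [right|left].
  have allK j : inner j -> j \in K.
    move=> inj; apply: contraNT K0 => jK; apply/eqP.
    apply: (@fourier_eq0 _ _ _ _ (symd [set i] [set j])) => [S|].
      exact: pow_beta_toggle2.
    by rewrite chi_symdr !chi1 iK (negbTE jK) mulr1.
  split=> //; move: evK; rewrite cK.
  have -> : K :\ first_pos :\ last_pos = setT :\ first_pos :\ last_pos.
    apply/setP=> j; rewrite !inK' inE andbT.
    by case: (boolP (inner j)) => //= /allK.
  have := cK setT; rewrite cardsT card_ord !inE /= => qE.
  by move: q_odd; rewrite [in odd q]qE !oddD !oddb /=; case: (odd _); case: (_ \in K); case: (_ \in K).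
have noneK j : inner j -> j \notin K.
  by move=> inj; have := none j; rewrite inj.
split=> //; move: evK; rewrite cK.
have -> : K :\ first_pos :\ last_pos = set0.
  apply/setP=> j; rewrite !inK' inE.
  by case: (boolP (inner j)) => //= /noneK/negbTE.
by rewrite cards0 !oddD; case: (_ \in K); case: (_ \in K).
Qed.

Lemma sum_sgn_pow_beta : \sum_S sgn S * pow_beta S = 0.
Proof.
have two_neq0 : 2 ^+ #|'I_q.+1.-1| != 0 :> algC by rewrite expf_neq0 ?pnatr_eq0.
apply: (mulfI two_neq0); rewrite sum_fourier mulr0 big1 // => K _.
(* The ends have odd 1-based positions 1 and q, so [sgn] kills every [K] containing one; only the
   empty set remains. *)
have dvd2 : (2 ^ 1 %| q.+1)%N by lia.
have [fK|fK] := boolP (first_pos \in K).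
  by rewrite (fourier_sgn_beta_eq0 _ dvd2 _ fK) ?mul0r.
have [lK|lK] := boolP (last_pos \in K).
  by rewrite (fourier_sgn_beta_eq0 _ dvd2 _ lK) ?mul0r //=; lia.
have [->|] := eqVneq (fourier pow_beta K) 0; first by rewrite mulr0.
case/fourier_pow_beta_neq0 => [[noneK _] | [_]]; last by rewrite (negbTE fK) lK.
have -> : K = set0.
  apply/setP=> i; rewrite inE; apply/negbTE.
  have [ini|] := boolP (inner i); first exact: noneK.
  by rewrite negb_and !negbK => /orP[/eqP->|/eqP->].
rewrite /fourier (eq_bigr sgn) => [|S _]; last by rewrite chi0 mulr1.
by rewrite sum_sgn_beta mul0r.
Qed.

Hypothesis q_mod4 : (4 %| q.+1)%N.

Lemma sum_chi_Des_symd_eq0 K L :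
  fourier pow_beta K != 0 -> fourier sgn L != 0 ->
  \sum_(s : 'S_q.+1) chi algC (symd K L) (Des s) = 0.
Proof.
move=> /fourier_pow_beta_neq0 K0 L0.
have dvdL i : i \in L -> (4 %| i.+1)%N.
  by move=> iL; apply: contraNT L0 => ni; rewrite (@fourier_sgn_beta_eq0 _ _ 2 _ i).
have fL : first_pos \notin L by apply/negP => /dvdL.
have lL : last_pos \notin L by apply/negP => /dvdL /=; lia.
have L1 : (0 < #|L|)%N.
  rewrite card_gt0; apply: contraNneq L0 => ->.
  rewrite /fourier (eq_bigr sgn) => [|S _]; last by rewrite chi0 mulr1.
  by rewrite sum_sgn_beta.
have evL : ~~ odd #|L|.
  apply: contraNN L0 => oL.
  by rewrite (@fourier_beta_odd _ _ (fun k => (-1) ^+ k)).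
case: K0 => [[noneK flK] | [allK flK]].
  have inM i : i \in symd K L -> inner i -> (4 %| i.+1)%N.
    by move=> + /noneK/negbTE iK; rewrite in_symd iK => /dvdL.
  (* If [K] consists of both ends, the first position is a run of length 1. *)
  have [fK|fK] := boolP (first_pos \in K).
    apply: (@sum_chi_Des_eq0 _ 0 1) => // [|i iM|i i01]; first by lia.
      split=> //; apply/eqP => i1; have := inM i iM.
      by rewrite innerE i1; lia.
    have -> : i = first_pos by apply: val_inj; move: i01 => /=; lia.
    by rewrite in_symd fK (negbTE fL).
  (* If [K] is empty, any element of [L] is isolated, [L] lying in the multiples of 4. *)
  have [k kL] : exists k, k \in L by apply/card_gt0P.
  have MK i : (i \in symd K L) = (i \in L).
    rewrite in_symd; have [/noneK/negbTE->//|] := boolP (inner i).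
    by rewrite negb_and !negbK => /orP[]/eqP->; rewrite -?flK (negbTE fK).
  have dk := dvdL _ kL.
  have lt_kn : (k.+1 < q.+1)%N by have := ltn_ord k.
  apply: (@sum_chi_Des_eq0 _ k k.+1) => // [|i|i ik]; first by lia.
    by rewrite MK => /dvdL; lia.
  by rewrite MK (_ : i = k) //; apply: val_inj; move: ik => /=; lia.
(* If [K] omits just one end, the gap between two consecutive elements of [L] is a run of length 3
   modulo 4. *)
have L2 : (1 < #|L|)%N by case: #|L| L1 evL => [|[]].
have [k [k' [kL k'L lt_kk' btw]]] := consecutive_elements L2.
have inner_dvd (i : 'I_q.+1.-1) : (4 %| i.+1)%N -> i \in K.
  move=> di; apply: allK; rewrite innerE; move: di (ltn_ord i) => /=; lia.
have lt_k'n : (k' < q.+1)%N by have := ltn_ord k'; rewrite /=; lia.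
have [dk dk'] := (dvdL _ kL, dvdL _ k'L).
apply: (@sum_chi_Des_eq0 _ k.+1 k') => // [|i iM|i ik]; first by lia.
  split; apply/eqP => E; move: iM.
    have -> : i = k by apply: val_inj; move: E => /=; lia.
    by rewrite in_symd kL inner_dvd.
  have -> : i = k' by apply: val_inj.
  by rewrite in_symd k'L inner_dvd.
rewrite in_symd (negbTE (btw i _)) ?addbF; last by lia.
by apply: allK; rewrite innerE; move: ik (ltn_ord k') => /=; lia.
Qed.

Lemma sum_sgn_pow_beta_beta : \sum_S sgn S * pow_beta S * (beta S)%:R = 0.
Proof.
have two_neq0 : 2 ^+ #|'I_q.+1.-1| != 0 :> algC by rewrite expf_neq0 ?pnatr_eq0.
(* One power of 2 for each of the two Fourier inversions below. *)
apply: (mulfI two_neq0); apply: (mulfI two_neq0); rewrite !mulr0.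
rewrite (sum_beta (fun S => sgn S * pow_beta S)) !mulr_sumr.
under eq_bigr => s _.
  rewrite mulrA mulrACA !fourier_inversion mulr_suml.
  under eq_bigr => L _ do rewrite mulr_sumr.
  over.
rewrite exchange_big big1 //= => L _; rewrite exchange_big big1 //= => K _.
have [->|K0] := eqVneq (fourier pow_beta K) 0.
  by rewrite big1 // => s _; rewrite mul0r mulr0.
have [->|L0] := eqVneq (fourier sgn L) 0.
  by rewrite big1 // => s _; rewrite mul0r mul0r.
under eq_bigr => s _ do rewrite mulrACA -chi_symdl symdC.
by rewrite -mulr_sumr sum_chi_Des_symd_eq0 // mulr0.
Qed.

End PrimePower.

Lemma horner_descent_poly n (z : algC) :
  (map_poly ratr (descent_poly n)).[z] = \sum_S z ^+ beta (S : {set 'I_n.-1}).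
Proof.
rewrite rmorph_sum horner_sum; apply: eq_bigr => S _.
by rewrite /= map_polyXn hornerXn.
Qed.

(** The factor [z] restores the exponent lowered by differentiation. *)
Lemma horner_deriv_descent_poly n (z : algC) :
  z * (map_poly ratr (descent_poly n)^`()).[z] =
  \sum_S z ^+ beta (S : {set 'I_n.-1}) * (beta S)%:R.
Proof.
rewrite -deriv_map rmorph_sum raddf_sum horner_sum mulr_sumr.
apply: eq_bigr => S _.
rewrite /= map_polyXn derivXn hornerMn hornerXn mulr_natr mulrnAr.
by case: (beta S) => [|b]; rewrite ?mulr0n // -exprS.
Qed.

Theorem theorem9p1 (p r q : nat) (p_prime : prime p) (p_odd : odd p)
    (r_gt0 : (0 < r)%N) (q_def : q = (p ^ r)%N)
    (rho_half : rho q.+1 = 1 / 2) :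
  Phi_rat (2 * p) %| descent_poly q.+1 /\
  (q = 3 %[mod 4] -> Phi_rat (2 * p) ^+ 2 %| descent_poly q.+1).
Proof.
have p_gt2 : (2 < p)%N by rewrite odd_prime_gt2.
have q_odd : odd q by rewrite q_def oddX p_odd orbT.
have q_gt2 : (2 < q)%N.
  by rewrite q_def (leq_trans p_gt2) // -{1}(expn1 p) leq_exp2l; lia.
have m_gt0 : (0 < 2 * p)%N by lia.
have [z prim_z] := C_prim_root_exists m_gt0.
have z0 : z != 0 by rewrite (prim_root_eq0 prim_z); lia.
(* The square of [z ^+ p] is 1, and [z ^+ p] is not 1 because [z] has order 2p. *)
have zp : z ^+ p = -1.
  have : (z ^+ p) ^+ 2 = 1 by rewrite -exprM mulnC prim_expr_order.
  move/eqP; rewrite sqrf_eq1 => /orP[|/eqP//].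
  by rewrite -(prim_order_dvd prim_z) => /dvdn_leq; lia.
have wp : (- z) ^+ p = 1 by rewrite exprNn -signr_odd p_odd zp mulrNN mulr1.
have zE (S : {set 'I_q.+1.-1}) :
    z ^+ beta S = sgn_beta algC S * pow_beta (- z) S.
  by rewrite /sgn_beta /pow_beta -exprMn mulN1r opprK.
have z_root : root (map_poly ratr (descent_poly q.+1)) z.
  rewrite /root horner_descent_poly; under eq_bigr do rewrite zE.
  by rewrite (sum_sgn_pow_beta p_prime q_def q_odd q_gt2 rho_half wp).
split=> [|q3]; first by rewrite (dvdp_Phi_rat prim_z).
have q_mod4 : (4 %| q.+1)%N by move: q3; lia.
apply: (dvdp_sqr_Phi_rat prim_z z_root).
rewrite /root -(mulrI_eq0 _ (mulfI z0)) horner_deriv_descent_poly.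
under eq_bigr do rewrite zE.
by rewrite (sum_sgn_pow_beta_beta p_prime q_def q_odd q_gt2 rho_half wp).
Qed.
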